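(* Let $m,n$ be positive integers. If $A_i,B_i,M_i,N_i,X\in B(\mathcal H)$, $i=1,2$, are such that (i) $M_i^{m_i}=N_i^{n_i}=0$, with $m_i$ and $n_i$ some positive integers ($i=1,2$); (ii) $[A_1,A_2]=[B_1,B_2]=[M_1,M_2]=[N_1,N_2]=[A_i,M_i]=[B_i,N_i]=0$ ($i=1,2$); and (iii) $((B_1,A_1),(B_2,A_2))\in$ left-$(X,(m,n))$-symmetric, then $$((B_1+N_1,A_1+M_1),(B_2+N_2,A_2+M_2))\in \text{left-}(X,(m+m_1+n_1-2,\,n+m_2+n_2-2))\text{-symmetric}.$$
   Context: $\mathcal H$ is an infinite dimensional complex Hilbert space, $B(\mathcal H)$ the algebra of bounded linear operators on $\mathcal H$, and $[A,B]=AB-BA$. For $A,B\in B(\mathcal H)$, $L_A(X)=AX$ and $R_B(X)=XB$ denote left and right multiplication acting on $B(\mathcal H)$. For a positive integer $k$ set $$\triangle_{B,A}^k(X)=(L_BR_A-I)^k(X)=\sum_{j=0}^k(-1)^j\binom{k}{j}B^{k-j}XA^{k-j},\qquad \delta_{B,A}^k(X)=(L_B-R_A)^k(X)=\sum_{j=0}^k(-1)^j\binom{k}{j}B^{k-j}XA^{j}.$$ Given operators $C_1,C_2,D_1,D_2,X\in B(\mathcal H)$ and positive integers $m,n$, such that $[C_1,C_2]=[D_1,D_2]=0$, the pairs $(D_1,C_1)$ and $(D_2,C_2)$ are said to be left-$(X,(m,n))$-symmetric, denoted $((D_1,C_1),(D_2,C_2))\in$ left-$(X,(m,n))$-symmetric,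 if $$\triangle^m_{D_1,C_1}\big(\delta^n_{D_2,C_2}(X)\big)=\delta^n_{D_2,C_2}\big(\triangle^m_{D_1,C_1}(X)\big)=0.$$
   Formalization: The formal theorem additionally assumes [A_1+M_1,A_2+M_2]=[B_1+N_1,B_2+N_2]=0, which the definition of left-symmetric requires for the conclusion; this does not follow from (ii), and without it the conclusion can fail. *)

(* Defs.v *)
From HB Require Import structures.
From mathcomp Require Import all_boot all_order all_algebra.
From mathcomp Require Import sesquilinear complex.
From mathcomp Require Import all_classical all_reals all_analysis.
Set Implicit Arguments.
Unset Strict Implicit.
Unset Printing Implicit Defensive.
Import Order.TTheory GRing.Theory Num.Theory.
Import numFieldNormedType.Exports.
Local Open Scope ring_scope.

(* A complex Hilbert space is a complete normed space over R[i] together with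
   a positive definite Hermitian form (linear in its first argument) that
   induces the norm. *)
Definition hilbert_norm (R : realType) (H : completeNormedModType R[i])
    (dotp : {dot H for Num.conj}) : Prop :=
  forall x : H, `|x| ^+ 2 = dotp x x.

Definition infinite_dimensional (K : numFieldType) (H : lmodType K) : Prop :=
  ~ exists (d : nat) (e : 'I_d -> H),
      forall x : H, exists c : 'I_d -> K, x = \sum_(i < d) c i *: e i.

Section BoundedOperators.
Context {K : numFieldType} (H : normedModType K).

Definition bounded_linear_op (f : H -> H) : Prop :=
  linear f /\ exists2 M : K, 0 <= M & forall x, `|f x| <= M * `|x|.

Definition bounded_op_pred : {pred H -> H} :=
  [pred f | `[< bounded_linear_op f >]].

Lemma bounded_op_predP f : reflect (bounded_linear_op f) (f \in bounded_op_pred).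
Proof. by rewrite inE; exact: asboolP. Qed.

Record bounded_op := BoundedOp {
  bop_fun :> H -> H;
  bop_funP : bop_fun \in bounded_op_pred }.

HB.instance Definition _ := [isSub for bop_fun].
HB.instance Definition _ := [Choice of bounded_op by <:].

Lemma bounded_op_submod_closed : submod_closed bounded_op_pred.
Proof.
split=> [|a f g].
  apply/bounded_op_predP; split=> [b x y|].
    by rewrite /= scaler0 addr0.
  by exists 0 => // x; rewrite /= normr0 mul0r.
move=> /bounded_op_predP[lf [M M0 fM]] /bounded_op_predP[lg [N N0 gN]].
apply/bounded_op_predP; split=> [b x y|].
  rewrite /= !fctE /= lf lg !scalerDr !scalerA (mulrC a b) -!addrA.
  by congr (_ + _); rewrite addrCA.
exists (`|a| * M + N) => [|x]; first by rewrite addr_ge0 ?mulr_ge0.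
rewrite !fctE /= mulrDl -mulrA (le_trans (ler_normD _ _))// lerD// normrZ.
by rewrite ler_wpM2l.
Qed.

HB.instance Definition _ :=
  GRing.isSubmodClosed.Build K (H -> H) bounded_op_pred bounded_op_submod_closed.
HB.instance Definition _ := [SubChoice_isSubLmodule of bounded_op by <:].

Lemma bop_linear (A : bounded_op) : linear A.
Proof. by case/bounded_op_predP: (bop_funP A). Qed.

Lemma bopP (A B : bounded_op) : A =1 B <-> A = B.
Proof. by split=> [AB|->//]; apply/val_inj/funext. Qed.

Lemma bop_addE (A B : bounded_op) x : (A + B) x = A x + B x.
Proof. by []. Qed.

Lemma bop_id_subproof : (idfun : H -> H) \in bounded_op_pred.
Proof.
by apply/bounded_op_predP; split=> //; exists 1 => // x; rewrite mul1r.
Qed.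

Lemma bop_comp_subproof (A B : bounded_op) : A \o B \in bounded_op_pred.
Proof.
case/bounded_op_predP: (bop_funP A) => lA [M M0 AM].
case/bounded_op_predP: (bop_funP B) => lB [N N0 BN].
apply/bounded_op_predP; split=> [b x y|]; first by rewrite /= lB lA.
exists (M * N) => [|x]; first exact: mulr_ge0.
by rewrite -mulrA (le_trans (AM _))// ler_wpM2l.
Qed.

Definition bop_id := BoundedOp bop_id_subproof.
Definition bop_comp (A B : bounded_op) := BoundedOp (bop_comp_subproof A B).

Lemma bop_compA : associative bop_comp.
Proof. by move=> A B C; apply/bopP. Qed.
Lemma bop_comp1o : left_id bop_id bop_comp.
Proof. by move=> A; apply/bopP. Qed.
Lemma bop_compo1 : right_id bop_id bop_comp.
Proof. by move=> A; apply/bopP. Qed.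
Lemma bop_compDl : left_distributive bop_comp +%R.
Proof. by move=> A B C; apply/bopP. Qed.
Lemma bop_compDr : right_distributive bop_comp +%R.
Proof.
move=> A B C; apply/bopP => x /=.
by have := bop_linear A 1 (B x) (C x); rewrite !scale1r.
Qed.

HB.instance Definition _ := GRing.Zmodule_isPzRing.Build bounded_op
  bop_compA bop_comp1o bop_compo1 bop_compDl bop_compDr.

Lemma bop_mulE (A B : bounded_op) x : (A * B) x = A (B x).
Proof. by []. Qed.

End BoundedOperators.

Section ElementaryOperators.
Context {S : pzRingType}.
Implicit Types A B C D X : S.

Definition commutator A B : S := A * B - B * A.

Definition Lmul A : S -> S := fun X => A * X.
Definition Rmul B : S -> S := fun X => X * B.

Definition triangle (k : nat) B A : S -> S :=
  iter k (fun Y => Lmul B (Rmul A Y) - Y).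

Definition delta (k : nat) B A : S -> S :=
  iter k (fun Y => Lmul B Y - Rmul A Y).

Let sgnM (F : S -> S) : {morph F : x y / x + y} ->
  forall x j n, F ((-1) ^+ j * x *+ n) = (-1) ^+ j * F x *+ n.
Proof.
move=> FD x j n.
have F0 : F 0 = 0 by apply: (addrI (F 0)); rewrite -FD !addr0.
have FN y : F (- y) = - F y by apply: (addrI (F y)); rewrite -FD !subrr F0.
have Fn y : F (y *+ n) = F y *+ n.
  by elim: n => [|i IH]; rewrite ?mulr0n ?mulrS ?F0 // FD IH.
by rewrite Fn -signr_odd; case: (odd j); rewrite ?expr1 ?expr0 ?mulN1r ?mul1r ?FN.
Qed.

Lemma iter_subE (P Q : S -> S) k X :
    {morph P : x y / x + y} -> {morph Q : x y / x + y} ->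
    (forall x, P (Q x) = Q (P x)) ->
  iter k (fun Y => P Y - Q Y) X =
  \sum_(j < k.+1) (-1) ^+ j * iter (k - j) P (iter j Q X) *+ 'C(k, j).
Proof.
move=> PD QD PQ.
have P0 : P 0 = 0 by apply: (addrI (P 0)); rewrite -PD !addr0.
have Q0 : Q 0 = 0 by apply: (addrI (Q 0)); rewrite -QD !addr0.
have QitP i x : Q (iter i P x) = iter i P (Q x).
  by elim: i => //= i IH; rewrite -PQ IH.
elim: k => [|k IH].
  by rewrite big_ord_recl big_ord0 /= addr0 expr0 mul1r.
rewrite iterS IH (big_morph P PD P0) (big_morph Q QD Q0).
rewrite [RHS]big_ord_recl.
under [X in _ = _ + X]eq_bigr => j _.
  rewrite /= /bump leq0n add1n subSS binS mulrnDr.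
  over.
rewrite [X in _ = _ + X]big_split /= addrA; congr (_ + _).
- rewrite [LHS]big_ord_recl (sgnM PD) !subn0 !bin0 -iterS; congr (_ + _).
  rewrite [RHS]big_ord_recr /= bin_small// mulr0n addr0.
  apply: eq_bigr => j _.
  by rewrite (sgnM PD) /bump leq0n add1n -iterS -subSn ?ltn_ord// subSS.
- rewrite -sumrN; apply: eq_bigr => j _.
  by rewrite (sgnM QD) QitP -iterS exprS mulN1r mulNr mulNrn.
Qed.

Lemma iter_mulE B A i j X : iter i (Lmul B) (iter j (Rmul A) X) = B ^+ i * X * A ^+ j.
Proof.
have -> : iter j (Rmul A) X = X * A ^+ j.
  elim: j => [|j /= ->]; first by rewrite expr0 mulr1.
  by rewrite /Rmul exprSr mulrA.
elim: i => [|i /= ->]; first by rewrite expr0 mul1r.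
by rewrite /Lmul exprS !mulrA.
Qed.

Lemma deltaE k B A X : delta k B A X =
  \sum_(j < k.+1) (-1) ^+ j * (B ^+ (k - j) * X * A ^+ j) *+ 'C(k, j).
Proof.
rewrite /delta iter_subE.
- by apply: eq_bigr => j _; rewrite iter_mulE.
- by move=> x y; rewrite /Lmul mulrDr.
- by move=> x y; rewrite /Rmul mulrDl.
- by move=> x; rewrite /Lmul /Rmul mulrA.
Qed.

Lemma triangleE k B A X : triangle k B A X =
  \sum_(j < k.+1) (-1) ^+ j * (B ^+ (k - j) * X * A ^+ (k - j)) *+ 'C(k, j).
Proof.
rewrite /triangle (@iter_subE (fun Y => Lmul B (Rmul A Y)) id) //.
- apply: eq_bigr => j _; congr (_ * _ *+ _).
  have -> : iter j id X = X by elim: (j : nat) => //= i ->.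
  elim: (k - j)%N => [|i /= ->]; first by rewrite !expr0 mul1r mulr1.
  by rewrite /Lmul /Rmul exprS exprSr !mulrA.
- by move=> x y; rewrite /Lmul /Rmul mulrDl mulrDr.
Qed.

(* The relation is only defined for commuting C1, C2 and commuting D1, D2:
   the last two arguments are the proofs of these standing requirements. *)
Definition left_symmetric X (m n : nat) D1 C1 D2 C2
    (hC : commutator C1 C2 = 0) (hD : commutator D1 D2 = 0) : Prop :=
  triangle m D1 C1 (delta n D2 C2 X) = 0 /\
  delta n D2 C2 (triangle m D1 C1 X) = 0.

End ElementaryOperators.

Arguments left_symmetric {S} X m n D1 C1 D2 C2 hC hD.

Notation "''B' ( H )" := (bounded_op H) (format "''B' ( H )") : type_scope.

(* Main.v *)
Require Import Defs.
From HB Require Import structures.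
From mathcomp Require Import all_boot all_order all_algebra.
From mathcomp Require Import sesquilinear complex.
From mathcomp Require Import zify.
From mathcomp Require Import all_classical all_reals all_analysis.
Set Implicit Arguments.
Unset Strict Implicit.
Unset Printing Implicit Defensive.
Import GRing.Theory Num.Theory.
Local Open Scope ring_scope.

(** Write L_B and R_A for left and right multiplication on a ring S.  Let
    T = L_{B1} R_{A1} - 1 and D = L_{B2} - R_{A2}; they commute, so
    left-symmetry of X says that T^m D^n kills X in the ring of additive
    endomorphisms of S.  Adding (M1, M2) to (A1, A2), and then (N1, N2) to
    (B1, B2), perturbs (T, D) each time by a pair of commuting nilpotents (x, y)
    such that x commutes with T and y with D.  Two perturbations of this kind
    give the exponents: the first adds m1 - 1 and m2 - 1, the second n1 - 1 and
    n2 - 1.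

    Nothing makes x commute with D, nor y with T, so it is not enough to pull a
    factor T^m out of (T + x)^p and a factor D^n out of (D + y)^q: the
    cofactors stand between these factors and X.  The remedy is that T + x and
    D + y commute, which forces [T, y] = [D, x] =: c.  As [T, y], c commutes
    with D and x; as [D, x], it commutes with T and y; hence it is central in
    the ring generated by T, D, x, y.  Applying [T, -] repeatedly to y^m2 = 0
    then gives c^k y^i = 0 for k + i >= m2, since S has no additive torsion.
    Let p = m + m1 - 1 and q = n + m2 - 1, and expand (D + y)^q (T + x)^p into
    terms y^i D^(q-i) x^j T^(p-j).  If j >= m1 the term vanishes; otherwise
    p - j >= m.  Moving D to the right past x loses, in the correction terms,
    one D and one x against one c, so that each resulting term
    c^k y^i x^(j-k) D^s T^(p-j) has k + i + s = q: either c^k y^i = 0 or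
    s >= n.  Thus the product is a left multiple of T^m D^n
    (left_multiple_perturbed). *)

(** * The ring of additive endomorphisms *)

Section EndomorphismRing.
Variable V : zmodType.

Definition additive_pred : {pred V -> V} :=
  [pred f | `[< {morph f : u v / u + v} >]].

Lemma additive_predP (f : V -> V) :
  reflect {morph f : u v / u + v} (f \in additive_pred).
Proof. by rewrite inE; exact: asboolP. Qed.

Record endo := Endo { endo_fun :> V -> V; endo_funP : endo_fun \in additive_pred }.

HB.instance Definition _ := [isSub for endo_fun].
HB.instance Definition _ := [Choice of endo by <:].

Lemma additive_pred_zmod_closed : zmod_closed additive_pred.
Proof.
split=> [|f g /additive_predP fD /additive_predP gD]; apply/additive_predP => u v.
  by rewrite addr0.
by rewrite !fctE fD gD opprD addrACA.
Qed.

HB.instance Definition _ :=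
  GRing.isZmodClosed.Build (V -> V) additive_pred additive_pred_zmod_closed.
HB.instance Definition _ := [SubChoice_isSubZmodule of endo by <:].

Lemma endoD (f : endo) : {morph f : u v / u + v}.
Proof. exact/additive_predP/endo_funP. Qed.

Lemma endoP (f g : endo) : f =1 g -> f = g.
Proof. by move=> fg; apply/val_inj/funext. Qed.

Lemma idfun_additive : (idfun : V -> V) \in additive_pred.
Proof. exact/additive_predP. Qed.

Lemma comp_additive (f g : endo) : f \o g \in additive_pred.
Proof. by apply/additive_predP => u v /=; rewrite !endoD. Qed.

Definition endo_comp (f g : endo) := Endo (comp_additive f g).

Lemma endo_compA : associative endo_comp.
Proof. by move=> f g h; apply: endoP. Qed.
Lemma endo_comp1o : left_id (Endo idfun_additive) endo_comp.
Proof. by move=> f; apply: endoP. Qed.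
Lemma endo_compo1 : right_id (Endo idfun_additive) endo_comp.
Proof. by move=> f; apply: endoP. Qed.
Lemma endo_compDl : left_distributive endo_comp +%R.
Proof. by move=> f g h; apply: endoP. Qed.
Lemma endo_compDr : right_distributive endo_comp +%R.
Proof. by move=> f g h; apply: endoP => v /=; exact: endoD. Qed.

HB.instance Definition _ := GRing.Zmodule_isPzRing.Build endo
  endo_compA endo_comp1o endo_compo1 endo_compDl endo_compDr.

Lemma endo0 (f : endo) : f 0 = 0.
Proof. by apply: (addrI (f 0)); rewrite -endoD !addr0. Qed.

Lemma endoXE (f : endo) k v : (f ^+ k) v = iter k f v.
Proof. by elim: k v => [|k IH] v //; rewrite exprS /= -IH. Qed.

End EndomorphismRing.

(** Stated without scalars, so that it makes sense for the endomorphism ring of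
    V, where the integer factors produced by differentiating powers have to be
    cancelled. *)
Definition torsion_free (V : zmodType) : Prop :=
  forall (k : nat) (v : V), v *+ k.+1 = 0 -> v = 0.

Lemma endo_torsion_free {V : zmodType} : torsion_free V -> torsion_free (endo V).
Proof.
move=> torsV k f fk0; apply: endoP => v; apply: (torsV k).
have -> : f v *+ k.+1 = (f *+ k.+1) v.
  by elim: k.+1 => // l IH; rewrite !mulrS IH.
by rewrite fk0.
Qed.

(** * Commuting nilpotent perturbations *)

Definition left_multiple (E : pzRingType) (w z : E) : Prop :=
  exists e, z = e * w.

Lemma left_multiple_sum (E : pzRingType) (w : E) k (F : 'I_k -> E) :
  (forall i, left_multiple w (F i)) -> left_multiple w (\sum_(i < k) F i).
Proof.
move=> wF; elim/big_ind: _ => [|_ _ [e ->] [f ->]|i _]; last exact: wF.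
  by exists 0; rewrite mul0r.
by exists (e + f); rewrite mulrDl.
Qed.

Lemma left_multipleMl {E : pzRingType} {w z : E} u :
  left_multiple w z -> left_multiple w (u * z).
Proof. by move=> [e ->]; exists (u * e); rewrite mulrA. Qed.

Lemma left_multipleMn {E : pzRingType} {w z : E} k :
  left_multiple w z -> left_multiple w (z *+ k).
Proof. by move=> [e ->]; exists (e *+ k); rewrite mulrnAl. Qed.

(** The commutator with u is a derivation, and it sends v to c. *)
Lemma central_commutator_exp (E : pzRingType) (u v c : E) l :
  u * v = v * u + c -> GRing.comm c v ->
  u * v ^+ l = v ^+ l * u + c * v ^+ l.-1 *+ l.
Proof.
move=> uv cv; elim: l => [|l IH]; first by rewrite mulr0n addr0 expr0 mul1r mulr1.
rewrite exprSr mulrA IH mulrDl -mulrA uv mulrDr mulrA -addrA; congr (_ + _).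
rewrite -(commrX l cv) mulrnAl -mulrA mulrS; congr (_ + _).
by case: l {IH} => // l; rewrite -exprSr.
Qed.

Section NilpotentPerturbation.
Variables (E : pzRingType) (a b x y : E) (m n m1 m2 : nat).
Hypothesis torsE : torsion_free E.
Hypotheses (cab : GRing.comm a b) (cxy : GRing.comm x y).
Hypotheses (cax : GRing.comm a x) (cby : GRing.comm b y).
Hypothesis cxy' : GRing.comm (a + x) (b + y).
Hypotheses (x_nil : x ^+ m1 = 0) (y_nil : y ^+ m2 = 0).

Let c := a * y - y * a.

(** Expand the commutation of a + x with b + y: only the mixed brackets
    remain. This second expression of c is what makes c central. *)
Let cE : c = b * x - x * b.
Proof.
have cross : a * y + x * b = b * x + y * a.
  apply: (addrI (b * a)); apply: (addIr (y * x)); move: cxy'.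
  rewrite /GRing.comm !mulrDl !mulrDr cab cxy -!addrA => ->.
  by [].
by apply/eqP; rewrite subr_eq addrAC eq_sym subr_eq cross.
Qed.

Let cca : GRing.comm c a.
Proof.
by rewrite cE; apply/commr_sym/commrB; apply: commrM => //; apply/commr_sym.
Qed.

Let ccb : GRing.comm c b.
Proof.
by rewrite /c; apply/commr_sym/commrB; apply: commrM => //; apply/commr_sym.
Qed.

Let ccx : GRing.comm c x.
Proof.
by rewrite /c; apply/commr_sym/commrB; apply: commrM => //; apply/commr_sym.
Qed.

Let ccy : GRing.comm c y.
Proof.
by rewrite cE; apply/commr_sym/commrB; apply: commrM => //; apply/commr_sym.
Qed.

(** Each bracket with a trades one factor y for a factor c, at the cost of an
    integer factor that torsion-freeness removes. *)
Let cy_eq0 k i : (m2 <= k + i)%N -> c ^+ k * y ^+ i = 0.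
Proof.
elim: k i => [|k IH] i le_m2.
  by rewrite mul1r -(subnK (le_m2 : m2 <= i)%N) exprD y_nil mulr0.
apply: (@torsE i).
have kS0 : c ^+ k * y ^+ i.+1 = 0 by apply: IH; rewrite addnS.
have := central_commutator_exp i.+1 (esym (subrKC (y * a) (a * y))) ccy.
move/(congr1 (fun z => c ^+ k * z)); rewrite mulrDr !mulrA kS0 mul0r add0r.
rewrite (commr_sym (commrX k (commr_sym cca))) -mulrA kS0 mulr0 => ->.
by rewrite mulrnAr mulrA -exprSr.
Qed.

(** Moving b past x lowers the exponent of b by one and raises that of c, so
    k + i + s is preserved by the rewriting; at j = 0 the bound leaves either
    c^k y^i = 0 or s >= n. *)
Let left_multiple_cybx k i s j : (n + m2 <= (k + i + s).+1)%N ->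
  left_multiple (b ^+ n) (c ^+ k * y ^+ i * b ^+ s * x ^+ j).
Proof.
elim: j k i s => [|j IH] k i s le_n.
  rewrite mulr1; have [le_m2|lt_m2] := leqP m2 (k + i).
    by exists 0; rewrite cy_eq0 // !mul0r.
  have le_ns : (n <= s)%N.
    by rewrite -(leq_add2r m2) (leq_trans le_n)// -addSn addnC leq_add2l.
  by rewrite -(subnK le_ns) exprD mulrA; exists (c ^+ k * y ^+ i * b ^+ (s - n)).
have bx : b ^+ s * x = x * b ^+ s + c * b ^+ s.-1 *+ s.
  have xb : x * b = b * x + - c by rewrite cE opprB subrKC.
  rewrite (central_commutator_exp s xb); last exact/commr_sym/commrN/commr_sym.
  by rewrite mulNr mulNrn addrNK.
have -> : c ^+ k * y ^+ i * b ^+ s * x ^+ j.+1 =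
    x * (c ^+ k * y ^+ i * b ^+ s * x ^+ j) +
    (c ^+ k.+1 * y ^+ i * b ^+ s.-1 * x ^+ j) *+ s.
  rewrite exprS mulrA -(mulrA _ _ x) bx mulrDr mulrDl; congr (_ + _).
    rewrite !mulrA; congr (_ * _ * _).
    rewrite -mulrA (commr_sym (commrX i cxy)) !mulrA.
    by rewrite -(commrX k (commr_sym ccx)).
  rewrite mulrnAr mulrnAl !mulrA exprSr; congr (_ * _ * _ *+ _).
  by rewrite -!mulrA -(commrX i ccy).
have [e1 ->] := left_multipleMl x (IH k i s le_n).
case: s le_n {bx} => [|s] le_n; first by exists e1; rewrite mulr0n addr0.
have /(left_multipleMn s.+1)[e2 ->] : left_multiple (b ^+ n)
    (c ^+ k.+1 * y ^+ i * b ^+ s * x ^+ j).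
  by apply: IH; rewrite !addSn -addnS.
by exists (e1 + e2); rewrite mulrDl.
Qed.

(** The order of the factors matters: b is on the left, so that the powers of
    b have to cross those of x, which c controls, and then meet b^n and a^m on
    the right. *)
Lemma left_multiple_perturbed :
  left_multiple (a ^+ m * b ^+ n)
    ((b + y) ^+ (n + m2 - 1) * (a + x) ^+ (m + m1 - 1)).
Proof.
rewrite (exprDn_comm _ cby) (exprDn_comm _ cax) mulr_suml.
apply: left_multiple_sum => i; rewrite mulr_sumr.
apply: left_multiple_sum => j; rewrite mulrnAl mulrnAr.
do 2!apply: left_multipleMn.
set p := (m + m1 - 1)%N; set q := (n + m2 - 1)%N.
have [le_m1|lt_m1] := leqP m1 j.
  by exists 0; rewrite -(subnK le_m1) exprD x_nil !mulr0 mul0r.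
have [le_ip le_jp] : (i <= q)%N /\ (j <= p)%N by rewrite !leq_ord.
have le_mp : (m <= p - j)%N by rewrite /p in le_jp *; lia.
have [|e ybx] := @left_multiple_cybx 0 i (q - i) j.
  by rewrite /q in le_ip *; lia.
exists (e * a ^+ (p - j - m)).
have commXX (u v : E) k l :
    GRing.comm u v -> u ^+ k * v ^+ l = v ^+ l * u ^+ k.
  by move=> uv; rewrite (commrX l (commr_sym (commrX k (commr_sym uv)))).
rewrite mul1r in ybx.
rewrite (commXX _ _ _ _ cby) (commXX _ _ _ _ cax) mulrA -(mulrA (y ^+ i)) -/q.
rewrite mulrA ybx -(mulrA e) -(commXX _ _ _ _ cab).
by rewrite (mulrA _ (a ^+ m)) -(mulrA e) -exprD subnK // mulrA.
Qed.

End NilpotentPerturbation.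

Lemma perturbed_annihilates (V : zmodType) (a b x y : endo V)
    (m n m1 m2 : nat) (v : V) :
    torsion_free V ->
    GRing.comm a b -> GRing.comm x y -> GRing.comm a x -> GRing.comm b y ->
    GRing.comm (a + x) (b + y) -> x ^+ m1 = 0 -> y ^+ m2 = 0 ->
  (a ^+ m * b ^+ n) v = 0 ->
  ((a + x) ^+ (m + m1 - 1) * (b + y) ^+ (n + m2 - 1)) v = 0.
Proof.
move=> torsV cab cxy cax cby cxy' x_nil y_nil abv0.
have [e] := left_multiple_perturbed m n (endo_torsion_free torsV)
  cab cxy cax cby cxy' x_nil y_nil.
rewrite (commrX _ (commr_sym (commrX _ cxy'))) => ->.
exact: etrans (congr1 e abv0) (endo0 e).
Qed.

(** * Left and right multiplications *)

Section Multiplications.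
Variable S : pzRingType.
Implicit Types A B C D X Y : S.

Lemma Lmul_additive A : Lmul A \in @additive_pred S.
Proof. by apply/additive_predP => X Y; rewrite /Lmul mulrDr. Qed.

Lemma Rmul_additive A : Rmul A \in @additive_pred S.
Proof. by apply/additive_predP => X Y; rewrite /Rmul mulrDl. Qed.

Definition Lendo A : endo S := Endo (Lmul_additive A).
Definition Rendo A : endo S := Endo (Rmul_additive A).

Lemma LendoD A B : Lendo (A + B) = Lendo A + Lendo B.
Proof. by apply: endoP => X; exact: mulrDl. Qed.

Lemma RendoD A B : Rendo (A + B) = Rendo A + Rendo B.
Proof. by apply: endoP => X; exact: mulrDr. Qed.

Lemma LendoX A k : Lendo A ^+ k = Lendo (A ^+ k).
Proof.
apply: endoP => X; rewrite endoXE /= /Lmul.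
by elim: k => [|k /= ->]; rewrite ?mul1r // exprS -mulrA.
Qed.

Lemma RendoX A k : Rendo A ^+ k = Rendo (A ^+ k).
Proof.
apply: endoP => X; rewrite endoXE /= /Rmul.
by elim: k => [|k /= ->]; rewrite ?mulr1 // exprSr mulrA.
Qed.

Lemma Lendo0 : Lendo 0 = 0.
Proof. by apply: endoP => X; exact: mul0r. Qed.

Lemma Rendo0 : Rendo 0 = 0.
Proof. by apply: endoP => X; exact: mulr0. Qed.

Lemma comm_Lendo A B : commutator A B = 0 -> GRing.comm (Lendo A) (Lendo B).
Proof.
by move=> /subr0_eq AB; apply: endoP => X /=; rewrite /Lmul !mulrA AB.
Qed.

Lemma comm_Rendo A B : commutator A B = 0 -> GRing.comm (Rendo A) (Rendo B).
Proof.
by move=> /subr0_eq AB; apply: endoP => X /=; rewrite /Rmul -!mulrA AB.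
Qed.

Lemma comm_LRendo A B : GRing.comm (Lendo A) (Rendo B).
Proof. by apply: endoP => X; exact: mulrA. Qed.

Definition triangle_endo B A := Lendo B * Rendo A - 1.
Definition delta_endo B A := Lendo B - Rendo A.

Lemma triangle_endoX k B A X : triangle k B A X = (triangle_endo B A ^+ k) X.
Proof. by rewrite endoXE. Qed.

Lemma delta_endoX k B A X : delta k B A X = (delta_endo B A ^+ k) X.
Proof. by rewrite endoXE. Qed.

Lemma comm_LRendoM A1 A2 B1 B2 : commutator A1 A2 = 0 -> commutator B1 B2 = 0 ->
  GRing.comm (Lendo B1 * Rendo A1) (Lendo B2) /\
  GRing.comm (Lendo B1 * Rendo A1) (Rendo A2).
Proof.
move=> cA cB; split; apply/commr_sym/commrM => //.
- exact/commr_sym/comm_Lendo.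
- exact: comm_LRendo.
- exact/commr_sym/comm_LRendo.
- exact/commr_sym/comm_Rendo.
Qed.

Lemma comm_triangle_delta A1 A2 B1 B2 :
    commutator A1 A2 = 0 -> commutator B1 B2 = 0 ->
  GRing.comm (triangle_endo B1 A1) (delta_endo B2 A2).
Proof.
move=> cA cB; have [cL cR] := comm_LRendoM cA cB.
apply/commr_sym/commrB; last exact: commr1.
by apply/commr_sym/commrB.
Qed.

(** The two conditions in the definition coincide, because commuting C's and
    D's make the two endomorphisms commute. *)
Lemma left_symmetricE X m n D1 C1 D2 C2
    (hC : commutator C1 C2 = 0) (hD : commutator D1 D2 = 0) :
  left_symmetric X m n D1 C1 D2 C2 hC hD <->
  (triangle_endo D1 C1 ^+ m * delta_endo D2 C2 ^+ n) X = 0.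
Proof.
rewrite /left_symmetric !triangle_endoX !delta_endoX.
have cTD := commrX m (commr_sym (commrX n (comm_triangle_delta hC hD))).
have -> : (delta_endo D2 C2 ^+ n) ((triangle_endo D1 C1 ^+ m) X) =
    (triangle_endo D1 C1 ^+ m * delta_endo D2 C2 ^+ n) X by rewrite -cTD.
by split=> [[]|].
Qed.

(** Adding M1 and M2 to the right factors perturbs the triangle endomorphism
    by L_{B1} R_{M1} and the delta endomorphism by - R_{M2}; both inherit
    nilpotency from M1 and M2. Perturbing one side at a time makes the two
    perturbations commute. *)
Lemma left_symmetric_perturb_right X (m n m1 m2 : nat) A1 A2 B1 B2 M1 M2
    (cA : commutator A1 A2 = 0) (cB : commutator B1 B2 = 0)
    (cA' : commutator (A1 + M1) (A2 + M2) = 0) :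
    torsion_free S ->
    M1 ^+ m1 = 0 -> M2 ^+ m2 = 0 -> commutator M1 M2 = 0 ->
    commutator A1 M1 = 0 -> commutator A2 M2 = 0 ->
  left_symmetric X m n B1 A1 B2 A2 cA cB ->
  left_symmetric X (m + m1 - 1) (n + m2 - 1) B1 (A1 + M1) B2 (A2 + M2) cA' cB.
Proof.
move=> torsS nilM1 nilM2 cM cAM1 cAM2 /left_symmetricE symAB.
have cB1 : commutator B1 B1 = 0 by exact: subrr.
apply/left_symmetricE.
have cT' := comm_triangle_delta cA' cB.
have TE : triangle_endo B1 (A1 + M1) = triangle_endo B1 A1 + Lendo B1 * Rendo M1.
  by rewrite /triangle_endo RendoD mulrDr addrAC.
have DE : delta_endo B2 (A2 + M2) = delta_endo B2 A2 + - Rendo M2.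
  by rewrite /delta_endo RendoD opprD addrA.
rewrite TE DE in cT' *.
apply: perturbed_annihilates => //.
- exact: comm_triangle_delta.
- apply: commrN; exact: (comm_LRendoM cM cB).2.
- have [cL cR] := comm_LRendoM cAM1 cB1.
  apply/commr_sym/commrB; last exact: commr1.
  exact/commr_sym/commrM.
- apply/commrN/commr_sym/commrB; first exact/commr_sym/comm_LRendo.
  exact/commr_sym/comm_Rendo.
- rewrite exprMn_comm; last exact: comm_LRendo.
  by rewrite RendoX nilM1 Rendo0 mulr0.
- by rewrite exprNn RendoX nilM2 Rendo0 mulr0.
Qed.

(** The perturbations are now L_{N1} R_{A1} and L_{N2}. The elements A1 and A2
    are arbitrary commuting ones, so the lemma applies after a perturbation of
    the right factors. *)
Lemma left_symmetric_perturb_left X (m n n1 n2 : nat) A1 A2 B1 B2 N1 N2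
    (cA : commutator A1 A2 = 0) (cB : commutator B1 B2 = 0)
    (cB' : commutator (B1 + N1) (B2 + N2) = 0) :
    torsion_free S ->
    N1 ^+ n1 = 0 -> N2 ^+ n2 = 0 -> commutator N1 N2 = 0 ->
    commutator B1 N1 = 0 -> commutator B2 N2 = 0 ->
  left_symmetric X m n B1 A1 B2 A2 cA cB ->
  left_symmetric X (m + n1 - 1) (n + n2 - 1) (B1 + N1) A1 (B2 + N2) A2 cA cB'.
Proof.
move=> torsS nilN1 nilN2 cN cBN1 cBN2 /left_symmetricE symAB.
have cA1 : commutator A1 A1 = 0 by exact: subrr.
apply/left_symmetricE.
have cT' := comm_triangle_delta cA cB'.
have TE : triangle_endo (B1 + N1) A1 = triangle_endo B1 A1 + Lendo N1 * Rendo A1.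
  by rewrite /triangle_endo LendoD mulrDl addrAC.
have DE : delta_endo (B2 + N2) A2 = delta_endo B2 A2 + Lendo N2.
  by rewrite /delta_endo LendoD addrAC.
rewrite TE DE in cT' *.
apply: perturbed_annihilates => //.
- exact: comm_triangle_delta.
- exact: (comm_LRendoM cA cN).1.
- have [cL cR] := comm_LRendoM cA1 cBN1.
  apply/commr_sym/commrB; last exact: commr1.
  exact/commr_sym/commrM.
- apply/commr_sym/commrB; last exact: comm_LRendo.
  exact/commr_sym/comm_Lendo.
- rewrite exprMn_comm; last exact: comm_LRendo.
  by rewrite LendoX nilN1 Lendo0 mul0r.
- by rewrite LendoX nilN2 Lendo0.
Qed.

End Multiplications.

Lemma lmod_torsion_free (K : numFieldType) (V : lmodType K) : torsion_free V.
Proof.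
move=> k v; rewrite -(scaler_nat k.+1 v) => /eqP.
by rewrite scaler_eq0 pnatr_eq0 /= => /eqP.
Qed.

Theorem theorem1p2 (R : realType) (H : completeNormedModType R[i])
    (dotp : {dot H for Num.conj})
    (hilbertH : hilbert_norm dotp)
    (infH : infinite_dimensional H)
    (m n m1 m2 n1 n2 : nat)
    (m_gt0 : (0 < m)%N) (n_gt0 : (0 < n)%N)
    (m1_gt0 : (0 < m1)%N) (m2_gt0 : (0 < m2)%N)
    (n1_gt0 : (0 < n1)%N) (n2_gt0 : (0 < n2)%N)
    (A1 A2 B1 B2 M1 M2 N1 N2 X : 'B(H))
    (nilM1 : M1 ^+ m1 = 0) (nilM2 : M2 ^+ m2 = 0)
    (nilN1 : N1 ^+ n1 = 0) (nilN2 : N2 ^+ n2 = 0)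
    (cA : commutator A1 A2 = 0) (cB : commutator B1 B2 = 0)
    (cM : commutator M1 M2 = 0) (cN : commutator N1 N2 = 0)
    (cAM1 : commutator A1 M1 = 0) (cAM2 : commutator A2 M2 = 0)
    (cBN1 : commutator B1 N1 = 0) (cBN2 : commutator B2 N2 = 0)
    (symAB : left_symmetric X m n B1 A1 B2 A2 cA cB)
    (* required for the concluding relation to be defined *)
    (cA' : commutator (A1 + M1) (A2 + M2) = 0)
    (cB' : commutator (B1 + N1) (B2 + N2) = 0) :
  left_symmetric X (m + m1 + n1 - 2) (n + m2 + n2 - 2)
    (B1 + N1) (A1 + M1) (B2 + N2) (A2 + M2) cA' cB'.
Proof.
have torsB : torsion_free 'B(H) by exact: lmod_torsion_free.
have symM :=
  left_symmetric_perturb_right cA' torsB nilM1 nilM2 cM cAM1 cAM2 symAB.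
have -> : (m + m1 + n1 - 2 = m + m1 - 1 + n1 - 1)%N by lia.
have -> : (n + m2 + n2 - 2 = n + m2 - 1 + n2 - 1)%N by lia.
exact: left_symmetric_perturb_left torsB nilN1 nilN2 cN cBN1 cBN2 symM.
Qed.
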